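(* For a tandem system with $M$ servers, Algorithm 3 (described in the context) using $P$ processors achieves the speedup $$S_P = O\left(\frac{M+1}{1+\lfloor M/P\rfloor}\right)\qquad\text{as } N\to\infty,$$ where $N$ is the number of customers simulated and the speedup is defined as $S_P=T_1/T_P$, with $T_P$ the time required by Algorithm 3 with $P$ processors and $T_1$ its time with one processor.
   Context: Tandem queue. Consider $M\ge 1$ single-server queues in series with infinite buffers, starting at time zero and free of customers at that time. Let $\tau_{0,j}\ge 0$ be the time between the arrivals of the $j$th customer and his predecessor, and $\tau_{i,j}\ge 0$ the service time of customer $j$ at server $i$ ($1\le i\le M$, $j\ge1$); these are given. Let $D_{0,j}$ be the $j$th arrival epoch to the system and $D_{i,j}$ the $j$th departure epoch from server $i$; let $B_{i,j}$ be the $j$th initiation of service at server $i$. With $D_{i,0}=0$ for $0\le i\le M$ and $D_{-1,j}=0$ for $j\ge1$, the dynamics are $$B_{i,j}=\max(D_{i-1,j},D_{i,j-1}),\qquad D_{i,j}=B_{i,j}+\tau_{i,j},\qquad 0\le i\le M,\ j\ge 1.$$ Algorithm 3 (parallel simulation of the first $N$ customers). For each $k=1,\dots,M+N$ in turn: first, in parallel for all integers $j$ with $\max(1,k-M)\le j\le \min(k,N)$, compute $B_{k-j,j}=\max(D_{k-j-1,j},D_{k-j,j-1})$; then, in parallel for all the same $j$, compute $D_{k-j,j}=B_{k-j,j}+\tau_{k-j,j}$. Time model. Each maximization and each addition takes one unit of time on one processor; time for index computation, data allocation and movement, and processor synchronization is ignored. If $P$ processors are available, a batch of $l$ operations to be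 done in parallel is split sequentially into groups of $P$ operations, so that it takes time $\lfloor (l-1)/P\rfloor+1$. Thus, if $l_k$ is the number of integers $j$ with $\max(1,k-M)\le j\le\min(k,N)$, the time of Algorithm 3 with $P$ processors is $$T_P=2\sum_{k=1}^{M+N}\left(\left\lfloor\frac{l_k-1}{P}\right\rfloor+1\right).$$ *)

(* Defs.v *)
From mathcomp Require Import all_boot all_order all_algebra.
From mathcomp Require Import all_classical all_reals all_analysis.

Set Implicit Arguments.
Unset Strict Implicit.
Unset Printing Implicit Defensive.

Import Order.TTheory GRing.Theory Num.Theory.

(* The elementary operations on the tandem recursion, indexed by server [i]
   (with [i = 0] the arrival stream) and customer [j]. *)
Inductive operation :=
  | Maximize of nat & nat  (* B_(i,j) := max (D_(i-1,j), D_(i,j-1)) *)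
  | Add of nat & nat.      (* D_(i,j) := B_(i,j) + tau_(i,j) *)

(* A parallel program: batches executed one after another, the operations
   inside a batch being independent of each other. *)
Definition program := seq (seq operation).

(* The customers [j] with [max (1, k - M) <= j <= min (k, N)]. The truncated
   subtraction is harmless because of the maximum with 1. *)
Definition customers (M N k : nat) : seq nat :=
  index_iota (maxn 1 (k - M)) (minn k N).+1.

Definition algorithm3 (M N : nat) : program :=
  flatten [seq [:: [seq Maximize (k - j) j | j <- customers M N k];
                   [seq Add (k - j) j | j <- customers M N k]]
          | k <- iota 1 (M + N)].

(* [floor ((l - 1) / P) + 1] unit-time groups. The case [l = 0] is separate
   since [floor (-1 / P) + 1 = 0] for [P >= 1], whereas [0.-1 = 0] in [nat]. *)
Definition batch_time (P l : nat) : nat :=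
  if l is l'.+1 then (l' %/ P).+1 else 0.

Definition run_time (P : nat) (prog : program) : nat :=
  \sum_(b <- prog) batch_time P (size b).

Lemma run_time_algorithm3 (P M N : nat) :
  run_time P (algorithm3 M N) =
  2 * \sum_(1 <= k < (M + N).+1) batch_time P (size (customers M N k)).
Proof.
rewrite /run_time /algorithm3 big_flatten big_map /index_iota subn1 /=.
rewrite big_distrr /=; apply: eq_bigr => k _.
by rewrite !big_cons big_nil !size_map addn0 mul2n addnn.
Qed.

Local Open Scope ring_scope.

Definition speedup (R : realType) (M P N : nat) : R :=
  (run_time 1 (algorithm3 M N))%:R / (run_time P (algorithm3 M N))%:R.

(* Main.v *)
(** For [M < k <= N] the [k]th batch has full size [M + 1] and no batch is
    larger, so [T_1 <= 2 (M + N) (M + 1)] and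
    [T_P >= 2 (N - M) (1 + M %/ P)]. Once [N > 2 M] we have
    [M + N <= 3 (N - M)], and [C = 3] works for all [M] and [P]. *)

Require Import Defs.
From mathcomp Require Import all_boot all_order all_algebra.
From mathcomp Require Import all_classical all_reals all_analysis.
From mathcomp Require Import ring zify.
Import Order.TTheory GRing.Theory Num.Theory.
Local Open Scope classical_set_scope.
Local Open Scope ring_scope.

Lemma batch_time1 (l : nat) : batch_time 1 l = l.
Proof. by case: l => //= l; rewrite divn1. Qed.

(** The range lies in the window from [k - M] to [k]. *)
Lemma size_customers_le (M N k : nat) : (size (customers M N k) <= M.+1)%N.
Proof. by rewrite size_iota; lia. Qed.

(** Neither cutoff, at 1 or at [N], shortens the window for such [k]. *)
Lemma size_customers_full (M N k : nat) :
  (M < k <= N)%N -> size (customers M N k) = M.+1.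
Proof. by rewrite size_iota; lia. Qed.

Lemma run_time1_le (M N : nat) :
  (run_time 1 (algorithm3 M N) <= 2 * ((M + N) * M.+1))%N.
Proof.
rewrite run_time_algorithm3 leq_mul2l /=.
have -> : ((M + N) * M.+1 = \sum_(1 <= k < (M + N).+1) M.+1)%N.
  by rewrite sum_nat_const_nat subn1.
by apply: leq_sum => k _; rewrite batch_time1 size_customers_le.
Qed.

Lemma run_time_ge (P M N : nat) : (M <= N)%N ->
  (2 * ((N - M) * (1 + M %/ P)) <= run_time P (algorithm3 M N))%N.
Proof.
move=> leMN; rewrite run_time_algorithm3 leq_mul2l /=.
(* Splitting at [M.+1] and [N.+1] separates filling, full and draining batches; only the full ones
   are kept in the bound. *)
rewrite (@big_cat_nat _ _ _ M.+1) ?ltnS ?leq_addr //=.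
rewrite (@big_cat_nat _ _ _ N.+1 M.+1) ?ltnS ?leq_addl //=.
rewrite (@eq_big_nat _ _ _ M.+1 N.+1 _ (fun=> 1 + M %/ P)%N).
  by rewrite sum_nat_const_nat subSS addnCA leq_addr.
by move=> k /size_customers_full ->.
Qed.

(** [C] is quantified before [M] and [P], so the bound is uniform in both; only the threshold on [N]
    may depend on them. *)
Theorem lemma2 (R : realType) :
  exists2 C : R, 0 < C &
    forall M P : nat, (1 <= M)%N -> (1 <= P)%N ->
      \forall N \near \oo,
        `|speedup R M P N| <= C * `|M.+1%:R / (1 + M %/ P)%N%:R|.
Proof.
exists 3%:R => // M P _ _.
exists (2 * M).+1 => // N /= ltMN.
have T1_le := run_time1_le M N.
have TP_ge : (2 * ((N - M) * (1 + M %/ P)) <= run_time P (algorithm3 M N))%N.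
  by apply: run_time_ge; lia.
rewrite /speedup !ger0_norm ?divr_ge0 //.
move: (run_time 1 _) (run_time P _) T1_le TP_ge => T1 TP T1_le TP_ge.
(* Positivity of [TP] allows cross-multiplication, which turns the goal into an inequality in
   [nat]. *)
have TP_gt0 : (0 < TP)%N.
  by apply: leq_trans TP_ge; rewrite !muln_gt0 subn_gt0 addn_gt0 /= andbT; lia.
rewrite mulrA ler_pdivrMr ?ltr0n // mulrAC ler_pdivlMr ?ltr0n //.
rewrite -!natrM ler_nat.
apply: (@leq_trans (2 * ((M + N) * M.+1) * (1 + M %/ P))).
  by rewrite leq_mul2r T1_le orbT.
apply: (@leq_trans (3 * M.+1 * (2 * ((N - M) * (1 + M %/ P))))).
  have -> : (3 * M.+1 * (2 * ((N - M) * (1 + M %/ P))) =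
             2 * (3 * (N - M) * M.+1) * (1 + M %/ P))%N by ring.
  (* With common factors cancelled, [M + N <= 3 * (N - M)] remains, which amounts to
     [2 * M <= N]. *)
  by rewrite leq_mul2r !leq_mul2l leq_mul2r; apply/orP; right; lia.
by rewrite leq_mul2l TP_ge orbT.
Qed.
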